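(* Let $N\ge2$, let $Y_1,\dots,Y_N\in[C]$ be i.i.d. with $\mathbb{P}(Y_i=a)=\pi_a$, $Y=(Y_1,\dots,Y_N)$, and let $B\in[0,1]^{C\times C}$. Let $A\in\{0,1\}^{N\times N}$ be a random symmetric matrix with zero diagonal such that for each $i<j$, $A_{ij}\mid(Y_i=a,Y_j=b)\sim\mathrm{Bern}(B_{ab})$, and $\{A_{ij}\}_{i<j}$ are independent given $Y$. Let $A_{\mathrm{up}}=\{A_{ij}:1\le i<j\le N\}$ be the collection of upper-triangular entries. Then $$I(Y;A)=I(Y;A_{\mathrm{up}})\;\le\;\sum_{i<j}I(A_{ij};Y_i,Y_j)\;=\;\binom{N}{2}\,I(A_{12};Y_1,Y_2).$$
   Context: $[C]=\{1,\dots,C\}$. Given $Y=y$, the edges $A_{ij}$ $(i<j)$ are independent Bernoulli variables with parameters $B_{y_iy_j}$. $I(\cdot;\cdot)$ is mutual information, and $I(A_{ij};Y_i,Y_j)$ is the mutual information between $A_{ij}$ and the pair $(Y_i,Y_j)$. *)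

(* Defs.v *)
From HB Require Import structures.
From mathcomp Require Import all_boot all_order all_algebra.
From mathcomp Require Import all_classical all_reals all_analysis.

Set Implicit Arguments.
Unset Strict Implicit.
Unset Printing Implicit Defensive.

Import Order.TTheory GRing.Theory Num.Theory.

Local Open Scope classical_set_scope.
Local Open Scope ring_scope.

(* Measurability with respect to the discrete sigma-algebra on the finite
   type U: every subset of U is a finite union of singletons. *)
Definition finite_rv (d : measure_display) (T : measurableType d)
    (U : finType) (X : T -> U) : Prop :=
  forall x : U, measurable (X @^-1` [set x]).

Definition pr (d : measure_display) (T : measurableType d) (R : realType)
    (P : probability T R) (E : set T) : R :=
  fine (P E).

(* Only meaningful when 0 < pr P F; hypotheses using it carry that guard. *)
Definition cond_pr (d : measure_display) (T : measurableType d)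
    (R : realType) (P : probability T R) (F E : set T) : R :=
  pr P (E `&` F) / pr P F.

(* The set function Q is pr P (independence) or cond_pr P F (independence
   conditionally on the event F). The X i take values in a finite type with
   the discrete sigma-algebra, so the E i range over all sets. *)
Definition mutually_independent (T : Type) (R : realType) (Q : set T -> R)
    (I U : finType) (X : I -> T -> U) : Prop :=
  forall (J : {set I}) (E : I -> set U),
    Q (\bigcap_(i in [set` J]) (X i @^-1` E i)) =
    \prod_(i in J) Q (X i @^-1` E i).

(* In nats. The convention 0 ln 0 = 0 is automatic: if P(X = x, Z = z) = 0 the
   whole term vanishes, and otherwise both marginals are positive. *)
Definition mutual_information (d : measure_display) (T : measurableType d)
    (R : realType) (P : probability T R) (U V : finType)
    (X : T -> U) (Z : T -> V) : R :=
  \sum_(x : U) \sum_(z : V)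
    let pxz := pr P (X @^-1` [set x] `&` Z @^-1` [set z]) in
    pxz * ln (pxz / (pr P (X @^-1` [set x]) * pr P (Z @^-1` [set z]))).

Definition upair (N : nat) : finType := {p : 'I_N * 'I_N | (p.1 < p.2)%N}.

Definition entry (T : Type) (N : nat) (A : T -> 'M[bool]_N) (i j : 'I_N) :
    T -> bool :=
  fun w => A w i j.

Definition upper (T : Type) (N : nat) (A : T -> 'M[bool]_N) :
    T -> {ffun upair N -> bool} :=
  fun w => [ffun p : upair N => A w (val p).1 (val p).2].

Definition labels (T : Type) (N C : nat) (Y : 'I_N -> T -> 'I_C) :
    T -> {ffun 'I_N -> 'I_C} :=
  fun w => [ffun i => Y i w].

(* Main.v *)
(* Given Y, the edges are independent and each depends on Y only through the
   labels of its two endpoints, so the joint law factorizes as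
   P(y, a) = P(y) \prod_p q_p(a_p | y_i, y_j), p = (i, j).  Hence the sum of the
   edge informations minus I(Y; A_up) is the Kullback-Leibler divergence from
   \prod_p P(A_p = a_p) to P(A_up = a), which is nonnegative because
   ln t <= t - 1.  Edges are exchangeable, so all edge informations agree, and A
   is an injective function of its upper triangle. *)
Require Import Defs.
From HB Require Import structures.
From mathcomp Require Import all_boot all_order all_algebra.
From mathcomp Require Import all_classical all_reals all_analysis.

Set Implicit Arguments.
Unset Strict Implicit.
Unset Printing Implicit Defensive.

Import Order.TTheory GRing.Theory Num.Theory.

Local Open Scope classical_set_scope.
Local Open Scope ring_scope.

Lemma ln_prod (R : realType) (I : finType) (F : I -> R) :
  (forall i, 0 < F i) -> ln (\prod_i F i) = \sum_i ln (F i).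
Proof.
move=> F0; suff [] : 0 < \prod_i F i /\ ln (\prod_i F i) = \sum_i ln (F i) by [].
elim/big_ind2: _ => [|x1 x2 y1 y2 [x0 <-] [y0 <-]|i _]; rewrite ?ln1//.
by rewrite mulr_gt0// lnM.
Qed.

(** * Laws of finite-valued random variables *)

Section FiniteRandomVariables.
Context (d : measure_display) (T : measurableType d).

Lemma finite_rv_preimage (U : finType) (X : T -> U) (E : set U) :
  finite_rv X -> measurable (X @^-1` E).
Proof.
move=> mX; rewrite [X in measurable X](_ : _ = \bigcup_(x in E) X @^-1` [set x]).
  by apply: fin_bigcup_measurable => //; exact: finite_finset.
by apply/seteqP; split=> [w Ew|w [x Ex /= ->]//]; exists (X w).
Qed.

Lemma finite_rv_comp (U V : finType) (f : U -> V) (X : T -> U) :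
  finite_rv X -> finite_rv (f \o X).
Proof. by move=> mX v; rewrite comp_preimage; exact: finite_rv_preimage. Qed.

Lemma preimage_pair (U V : Type) (X : T -> U) (Z : T -> V) u v :
  (fun w => (X w, Z w)) @^-1` [set (u, v)] =
  X @^-1` [set u] `&` Z @^-1` [set v].
Proof. by apply/seteqP; split=> w /= [-> ->]. Qed.

Lemma finite_rv_pair (U V : finType) (X : T -> U) (Z : T -> V) :
  finite_rv X -> finite_rv Z -> finite_rv (fun w => (X w, Z w)).
Proof. by move=> mX mZ [u v]; rewrite preimage_pair; exact: measurableI. Qed.

Context (R : realType) (P : probability T R).

Lemma pr_ge0 E : 0 <= pr P E.
Proof. exact/fine_ge0/measure_ge0. Qed.

Lemma le_pr E F : measurable E -> measurable F -> E `<=` F ->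
  pr P E <= pr P F.
Proof.
by move=> mE mF EF; rewrite fine_le ?fin_num_measure// le_measure ?inE.
Qed.

Lemma pr_preimage (U : finType) (X : T -> U) (Q : pred U) : finite_rv X ->
  pr P (X @^-1` [set` Q]) = \sum_(u | Q u) pr P (X @^-1` [set u]).
Proof.
move=> mX.
have -> : X @^-1` [set` Q] = \bigcup_(u in [set` Q]) X @^-1` [set u].
  by apply/seteqP; split=> [w Ew|w [x Ex /= ->]//]; exists (X w).
rewrite /pr measure_fin_bigcup//; last by move=> i j _ _ [w [/= -> ->]].
have -> : [set` Q] = [set` enum Q] by apply/seteqP; split=> u; rewrite /= mem_enum.
rewrite -fsbig_seq ?enum_uniq// big_enum /=.
rewrite sum_fine// => u _; exact: fin_num_measure.
Qed.

Lemma pr_comp (U V : finType) (f : U -> V) (X : T -> U) v : finite_rv X ->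
  pr P ((f \o X) @^-1` [set v]) = \sum_(u | f u == v) pr P (X @^-1` [set u]).
Proof.
move=> mX; rewrite -pr_preimage// comp_preimage.
by congr (pr P (X @^-1` _)); apply/seteqP; split=> u /= /eqP.
Qed.

Lemma pr_compI (U V S : finType) (f : U -> V) (X : T -> U) (Z : T -> S) v z :
    finite_rv X -> finite_rv Z ->
  pr P ((f \o X) @^-1` [set v] `&` Z @^-1` [set z]) =
  \sum_(u | f u == v) pr P (X @^-1` [set u] `&` Z @^-1` [set z]).
Proof.
move=> mX mZ; pose W w := (X w, Z w).
have mW : finite_rv W by exact: finite_rv_pair.
transitivity (pr P (W @^-1` [set` [pred p | (f p.1 == v) && (p.2 == z)]])).
  congr pr; apply/seteqP; split=> w /=.
    by case=> /eqP fv /eqP zv; apply/andP.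
  by case/andP=> /eqP fv /eqP zv.
rewrite pr_preimage//; under [RHS]eq_bigr do rewrite -preimage_pair.
transitivity (\sum_(u | f u == v) \sum_(z' | z' == z) pr P (W @^-1` [set (u, z')])).
  by rewrite pair_big; apply: eq_big => -[].
by apply: eq_bigr => u _; rewrite big_pred1_eq.
Qed.

(** Change of variables for expectations: split the sum over [u] along the fibres of [f], on each of
    which [g (f u)] is constant. *)
Lemma sum_pr_comp (U V : finType) (f : U -> V) (X : T -> U) (g : V -> R) :
  finite_rv X ->
  \sum_v pr P ((f \o X) @^-1` [set v]) * g v =
  \sum_u pr P (X @^-1` [set u]) * g (f u).
Proof.
move=> mX; rewrite [RHS](partition_big f predT)//=.
apply: eq_bigr => v _; rewrite pr_comp// mulr_suml.
by apply: eq_bigr => u /eqP ->.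
Qed.

Lemma sum_pr1 (U : finType) (X : T -> U) : finite_rv X ->
  \sum_u pr P (X @^-1` [set u]) = 1.
Proof.
move=> mX; rewrite -(pr_preimage predT)//.
by rewrite [X in pr P X](_ : _ = setT) ?/pr ?probability_setT//; apply/seteqP.
Qed.

Lemma pr_marginal (U V : finType) (X : T -> U) (Z : T -> V) u :
  finite_rv X -> finite_rv Z ->
  pr P (X @^-1` [set u]) =
  \sum_v pr P (X @^-1` [set u] `&` Z @^-1` [set v]).
Proof.
move=> mX mZ; under eq_bigr do rewrite setIC.
(* The full sum is read as the sum over the single fibre of the constant map to [unit]. *)
rewrite (eq_bigl (fun=> tt == tt))// -(pr_compI (fun=> tt))//.
by congr pr; apply/seteqP; split=> w //= [].
Qed.

(** * Mutual information of finite-valued variables *)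

(** Both marginals are sums of the joint law, so the joint law alone determines the information.
    This is what allows different edges to be compared. *)
Lemma eq_mutual_information (U V : finType) (X X' : T -> U) (Z Z' : T -> V) :
    finite_rv X -> finite_rv X' -> finite_rv Z -> finite_rv Z' ->
    (forall x z, pr P (X @^-1` [set x] `&` Z @^-1` [set z]) =
                 pr P (X' @^-1` [set x] `&` Z' @^-1` [set z])) ->
  mutual_information P X Z = mutual_information P X' Z'.
Proof.
move=> mX mX' mZ mZ' eXZ; apply: eq_bigr => x _; apply: eq_bigr => z _ /=.
rewrite eXZ; congr (_ * ln (_ / (_ * _))).
  by rewrite (pr_marginal _ mX mZ) (pr_marginal _ mX' mZ'); apply: eq_bigr.
rewrite (pr_marginal _ mZ mX) (pr_marginal _ mZ' mX').
by apply: eq_bigr => u _; rewrite setIC eXZ setIC.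
Qed.

(** Writes the information as an expectation under the law of a common variable [W], so that
    informations of different pairs can be compared term by term. *)
Lemma mutual_information_comp (S U V : finType) (f : S -> U) (g : S -> V)
    (W : T -> S) : finite_rv W ->
  mutual_information P (f \o W) (g \o W) =
  \sum_s pr P (W @^-1` [set s]) *
    ln (pr P ((f \o W) @^-1` [set f s] `&` (g \o W) @^-1` [set g s]) /
        (pr P ((f \o W) @^-1` [set f s]) * pr P ((g \o W) @^-1` [set g s]))).
Proof.
move=> mW; rewrite /mutual_information pair_big/=.
rewrite -(sum_pr_comp (fun s => (f s, g s)) (fun p =>
  ln (pr P ((f \o W) @^-1` [set p.1] `&` (g \o W) @^-1` [set p.2]) /
    (pr P ((f \o W) @^-1` [set p.1]) * pr P ((g \o W) @^-1` [set p.2])))))//=.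
by apply: eq_bigr => -[x z] _; rewrite -preimage_pair.
Qed.

Lemma mutual_information_injr (U V V' : finType) (g : V -> V') (X : T -> U)
    (Z : T -> V) : finite_rv X -> finite_rv Z -> injective g ->
  mutual_information P X (g \o Z) = mutual_information P X Z.
Proof.
move=> mX mZ gI; pose W w := (X w, Z w).
have mW : finite_rv W by exact: finite_rv_pair.
(* Both sides become expectations under the law of [(X, Z)]; injectivity makes the events in the
   logarithms coincide. *)
rewrite [LHS](@mutual_information_comp _ _ _ fst (g \o snd) W)//.
rewrite [RHS](@mutual_information_comp _ _ _ fst snd W)//.
suff E (s : U * V) : ((g \o snd) \o W) @^-1` [set (g \o snd) s] = (snd \o W) @^-1` [set s.2].
  by apply: eq_bigr => s _; rewrite E.
by apply/seteqP; split=> [w /= /gI|w /= ->].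
Qed.

(* The hypothesis says that, given X, the components Z i are independent and
   each depends on X only through h i X; it is vacuous at the x of probability
   0, where both sides are 0. *)
Lemma mutual_information_le_sum (I U K V : finType) (X : T -> U)
    (Z : T -> {ffun I -> V}) (h : I -> U -> K) :
    finite_rv X -> finite_rv Z ->
    (forall x z, pr P (X @^-1` [set x] `&` Z @^-1` [set z]) =
       pr P (X @^-1` [set x]) *
       \prod_i (pr P ((fun w => Z w i) @^-1` [set z i] `&`
                      (h i \o X) @^-1` [set h i x]) /
                pr P ((h i \o X) @^-1` [set h i x]))) ->
  mutual_information P X Z <=
  \sum_i mutual_information P (fun w => Z w i) (h i \o X).
Proof.
move=> mX mZ XZ; pose W w := (X w, Z w).
have mW : finite_rv W by exact: finite_rv_pair.
have mZi i : finite_rv (fun w => Z w i).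
  exact: (finite_rv_comp (fun z : {ffun I -> V} => z i) mZ).
have mhX i : finite_rv (h i \o X) by exact: finite_rv_comp.
rewrite [leLHS](@mutual_information_comp _ _ _ fst snd W)//.
under [leRHS]eq_bigr => i _ do
  rewrite (@mutual_information_comp _ _ _ (fun s : U * {ffun I -> V} => s.2 i) (h i \o fst) W)//.
rewrite exchange_big/=.
pose pz z := pr P (Z @^-1` [set z]).
pose rz (z : {ffun I -> V}) := \prod_i pr P ((fun w => Z w i) @^-1` [set z i]).
rewrite -subr_le0 -sumrB.
(* The right-hand side minus the left-hand side is - E[ln (rz / pz)], bounded
   below by - E[rz / pz - 1]. *)
have E0 : \sum_z pz z * (rz z / pz z - 1) <= 0.
  (* [rz] is a product of probability mass functions: expand the product of their sums, each equal
     to 1. *)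
  have srz : \sum_z rz z = 1.
    rewrite -(bigA_distr_bigA (fun i v => pr P ((fun w => Z w i) @^-1` [set v]))).
    by rewrite big1// => i _; exact: sum_pr1.
  apply: (@le_trans _ _ (\sum_z (rz z - pz z))); last first.
    by rewrite sumrB srz sum_pr1// subrr.
  apply: ler_sum => z _.
  (* Only an inequality holds here: where [pz z] is 0 the left term vanishes, while [rz z] may be
     positive. *)
  rewrite mulrBr mulr1 lerB//; have [->|z0] := eqVneq (pz z) 0.
    by rewrite mul0r prodr_ge0// => i _; exact: pr_ge0.
  by rewrite mulrC divfK.
apply: le_trans E0; rewrite (sum_pr_comp snd (fun z => rz z / pz z - 1) mW).
apply: ler_sum => -[x z] _ /=.
have := pr_ge0 (W @^-1` [set (x, z)]); rewrite le0r => /predU1P[->|p0].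
  by rewrite !mul0r big1 ?subr0// => i _; rewrite mul0r.
rewrite -mulr_sumr -mulrBr ler_pM2l//.
(* Every event below contains the atom [(X, Z) = (x, z)] of positive probability, so all logarithms
   and quotients are genuine. *)
have gt0 E : measurable E -> W @^-1` [set (x, z)] `<=` E -> 0 < pr P E.
  by move=> mE WE; exact: lt_le_trans (le_pr _ _ WE).
have X0 : 0 < pr P (X @^-1` [set x]) by apply: (gt0 _ (mX x)) => w [].
have Z0 : 0 < pz z by apply: (gt0 _ (mZ z)) => w [].
have Zi0 i : 0 < pr P ((fun w => Z w i) @^-1` [set z i]).
  by apply: (gt0 _ (mZi i _)) => w [_ /= ->].
have hX0 i : 0 < pr P ((h i \o X) @^-1` [set h i x]).
  by apply: (gt0 _ (mhX i _)) => w [/= ->].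
have J0 i : 0 < pr P ((fun w => Z w i) @^-1` [set z i] `&`
                      (h i \o X) @^-1` [set h i x]).
  by apply: (gt0 _ (measurableI _ _ (mZi i _) (mhX i _))) => w [/= -> ->].
rewrite -ln_prod; last first.
  by move=> i; apply: divr_gt0 (J0 i) (mulr_gt0 (Zi0 i) (hX0 i)).
pose L := \prod_i
  (pr P ((fun w => Z w i) @^-1` [set z i] `&` (h i \o X) @^-1` [set h i x]) /
   (pr P ((fun w => Z w i) @^-1` [set z i]) *
    pr P ((h i \o X) @^-1` [set h i x]))).
have L0 : 0 < L.
  by apply: prodr_gt0 => i _; apply: divr_gt0 (J0 i) (mulr_gt0 (Zi0 i) (hX0 i)).
have t0 : 0 < rz z / pz z by rewrite divr_gt0//; exact: prodr_gt0.
(* With [t = rz z / pz z], the first logarithm is that of [L * t]; [ln L] cancels and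
   [ln t <= t - 1] remains. The factorization hypothesis then justifies [L * t]. *)
rewrite -[X in _ - ln X]/L [X in ln X - _](_ : _ = L * (rz z / pz z)).
  rewrite lnM// addrAC subrr add0r -[in leLHS](subrK 1 (rz z / pz z)) addrC.
  by rewrite le_ln1Dx// ltrBrDl subrr.
rewrite XZ invfM mulrACA divff ?gt_eqF// mul1r [RHS]mulrA; congr (_ / _).
rewrite -big_split/=; apply: eq_bigr => i _.
by rewrite [X in _ = _ / X * _]mulrC invfM mulrA divfK// gt_eqF.
Qed.

End FiniteRandomVariables.

(** * Sums over pairs [i < j] *)

Lemma sum_upair (V : nmodType) (N : nat) (F : 'I_N -> 'I_N -> V) :
  \sum_(i < N) \sum_(j < N | (i < j)%N) F i j =
  \sum_(p : upair N) F (val p).1 (val p).2.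
Proof.
rewrite pair_big_dep/=.
exact: (big_sub (fun p : 'I_N * 'I_N => p.1 < p.2)%N (fun p => F p.1 p.2)).
Qed.

Lemma sum_ltn_const (V : nmodType) (N : nat) (x : V) :
  \sum_(i < N) \sum_(j < N | (i < j)%N) x = x *+ 'C(N, 2).
Proof.
(* After the exchange, each [j] has exactly [j] smaller indices, and these counts add up to
   ['C(N, 2)]. *)
rewrite (exchange_big_dep predT)//= -bin2_sum big_mkord -sumrMnr.
apply: eq_bigr => j _; rewrite -(big_ord_widen N (fun=> x) (ltnW (ltn_ord j))).
by rewrite sumr_const card_ord.
Qed.

Theorem theorem20 (R : realType) (d : measure_display) (T : measurableType d)
    (P : probability T R) (N C : nat) (hN : (2 <= N)%N)
    (pi_ : 'I_C -> R) (B : 'M[R]_C)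
    (hB : forall a b : 'I_C, 0 <= B a b <= 1)
    (Y : 'I_N -> T -> 'I_C) (A : T -> 'M[bool]_N)
    (mY : forall i : 'I_N, finite_rv (Y i))
    (mA : finite_rv A)
    (Y_indep : mutually_independent (pr P) Y)
    (Y_law : forall (i : 'I_N) (a : 'I_C), pr P (Y i @^-1` [set a]) = pi_ a)
    (A_sym : forall w : T, (A w)^T = A w)
    (A_diag : forall (w : T) (i : 'I_N), A w i i = false)
    (A_law : forall y : {ffun 'I_N -> 'I_C},
       0 < pr P (labels Y @^-1` [set y]) ->
       forall (i j : 'I_N) (e : bool), (i < j)%N ->
         cond_pr P (labels Y @^-1` [set y]) (entry A i j @^-1` [set e]) =
         bernoulli_pmf (B (y i) (y j)) e)
    (A_indep : forall y : {ffun 'I_N -> 'I_C},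
       0 < pr P (labels Y @^-1` [set y]) ->
       mutually_independent (cond_pr P (labels Y @^-1` [set y]))
         (fun p : upair N => entry A (val p).1 (val p).2)) :
  let I_edge (i j : 'I_N) :=
    mutual_information P (entry A i j) (fun w => (Y i w, Y j w)) in
  let i1 : 'I_N := Ordinal (ltnW hN) in
  let i2 : 'I_N := Ordinal hN in
  [/\ mutual_information P (labels Y) A =
      mutual_information P (labels Y) (upper A),
      mutual_information P (labels Y) (upper A) <=
      \sum_(i < N) \sum_(j < N | (i < j)%N) I_edge i j &
      \sum_(i < N) \sum_(j < N | (i < j)%N) I_edge i j =
      'C(N, 2)%:R * I_edge i1 i2].
Proof.
move=> I_edge i1 i2.
have mL : finite_rv (labels Y).
  move=> y; have -> : labels Y @^-1` [set y] =
      \bigcap_(i in [set: 'I_N]) (Y i @^-1` [set y i]).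
    apply/seteqP; split=> [w /= <- i _|w yw]; first by rewrite /= ffunE.
    by apply/ffunP => i; rewrite ffunE; exact: yw.
  by apply: fin_bigcap_measurable => // i _; exact: mY.
have mU : finite_rv (upper A).
  exact: (finite_rv_comp
    (fun M : 'M[bool]_N => [ffun p : upair N => M (val p).1 (val p).2]) mA).
have mE i j : finite_rv (entry A i j).
  exact: (finite_rv_comp (fun M : 'M[bool]_N => M i j) mA).
have mYY i j : finite_rv (fun w => (Y i w, Y j w)) by exact: finite_rv_pair.
have LYY i j : (fun w => (Y i w, Y j w)) =
    (fun y : {ffun 'I_N -> 'I_C} => (y i, y j)) \o labels Y.
  by apply/funext => w; rewrite /= !ffunE.
have pr0I E F : measurable E -> measurable F -> pr P E = 0 -> pr P (E `&` F) = 0.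
  move=> mE' mF E0; apply/eqP; rewrite eq_le pr_ge0 andbT -E0.
  by apply: le_pr => //; exact: measurableI.
(* The product form holds for every [y]: when [y] has probability 0, both sides are 0. *)
have edge_labels (i j : 'I_N) y e : (i < j)%N ->
    pr P (labels Y @^-1` [set y] `&` entry A i j @^-1` [set e]) =
    pr P (labels Y @^-1` [set y]) * bernoulli_pmf (B (y i) (y j)) e.
  move=> ij; have := pr_ge0 P (labels Y @^-1` [set y]).
  rewrite le0r => /predU1P[y0|y0]; first by rewrite y0 mul0r (pr0I _ _ (mL y) (mE i j e) y0).
  by rewrite -A_law// /cond_pr mulrCA divff ?gt_eqF// mulr1 setIC.
(* Sum the previous identity over all [y] with [(y i, y j) = (a, b)]; the Bernoulli parameter is
   constant there and factors out. *)
have edge_law (i j : 'I_N) e a b : (i < j)%N ->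
    pr P (entry A i j @^-1` [set e] `&` (fun w => (Y i w, Y j w)) @^-1` [set (a, b)])
    = pr P ((fun w => (Y i w, Y j w)) @^-1` [set (a, b)]) * bernoulli_pmf (B a b) e.
  move=> ij; rewrite setIC LYY pr_compI// pr_comp// mulr_suml.
  by apply: eq_bigr => y /eqP[<- <-]; rewrite edge_labels.
split.
(* [g] rebuilds the matrix from its upper triangle, reading whichever of [(i, j)] and [(j, i)] is
   increasing; on the diagonal neither is. *)
- pose g (u : {ffun upair N -> bool}) : 'M[bool]_N := \matrix_(i, j)
    match insub (i, j), insub (j, i) with
    | Some p, _ => u p | None, Some p => u p | _, _ => false end.
  have AE : A = g \o upper A.
    apply/funext => w; apply/matrixP => i j; rewrite /= mxE.
    case: insubP => [p _ pE|ij]; first by rewrite ffunE pE.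
    case: insubP => [p _ pE|ji]; first by rewrite ffunE pE -[in LHS]A_sym mxE.
    have -> : i = j by apply/val_inj/eqP; rewrite eqn_leq leqNgt ji leqNgt ij.
    exact: A_diag.
  rewrite {1}AE mutual_information_injr// => u v /matrixP uv.
  apply/ffunP => p; have := uv (val p).1 (val p).2.
  by rewrite !mxE -surjective_pairing valK.
- rewrite sum_upair.
  pose h (p : upair N) (y : {ffun 'I_N -> 'I_C}) := (y (val p).1, y (val p).2).
  have hE (p : upair N) :
      (fun w => (Y (val p).1 w, Y (val p).2 w)) = h p \o labels Y := LYY _ _.
  have eE (p : upair N) :
      entry A (val p).1 (val p).2 = fun w => upper A w p.
    by apply/funext => w; rewrite ffunE.
  rewrite /I_edge; under eq_bigr do rewrite hE eE.
  apply: mutual_information_le_sum => // y u.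
  have := pr_ge0 P (labels Y @^-1` [set y]).
  rewrite le0r => /predU1P[y0|y0]; first by rewrite y0 mul0r (pr0I _ _ (mL y) (mU u) y0).
  (* Conditional independence for all pairs at once, with singleton events, yields the product law
     of the whole upper triangle. *)
  have /(_ [set: upair N]%SET (fun p => [set u p])) := A_indep y y0.
  rewrite {1}/cond_pr => /(canRL (divfK _)) yu.
  have -> : labels Y @^-1` [set y] `&` upper A @^-1` [set u] =
      \bigcap_(p in [set` [set: upair N]%SET])
        (entry A (val p).1 (val p).2 @^-1` [set u p]) `&` labels Y @^-1` [set y].
    rewrite setIC; congr (_ `&` _); apply/seteqP; split=> [w /= <- p _|w uw].
      by rewrite /= ffunE.
    by apply/ffunP => p; rewrite ffunE; apply: uw; rewrite /= inE.
  rewrite yu ?gt_eqF// mulrC; congr (_ * _).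
  apply: eq_big => [p|p _]; first by rewrite inE.
  rewrite A_law//; last exact: (valP p).
  rewrite -eE -hE edge_law; last exact: (valP p).
  (* The endpoint-label event contains the event [labels Y = y], so its probability is positive and
     cancels. *)
  rewrite mulrC mulKf// gt_eqF// (lt_le_trans y0)//.
  apply: le_pr => [||w /= <-]; [exact: mL|exact: mYY|by rewrite /h !ffunE].
- have YY (i j : 'I_N) a b : (i < j)%N ->
      pr P ((fun w => (Y i w, Y j w)) @^-1` [set (a, b)]) = pi_ a * pi_ b.
    move=> ij; have ji : j != i by rewrite neq_ltn ij orbT.
    (* Independence on the two-element set; the test [k == i] separates the two events because
       [j != i]. *)
    have := Y_indep [set i; j]%SET (fun k => if k == i then [set a] else [set b]).
    rewrite big_setU1 ?inE 1?eq_sym// big_set1 eqxx (negPf ji) !Y_law => <-.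
    rewrite preimage_pair; congr pr; apply/seteqP; split=> w.
      by case=> Yi Yj k; rewrite /= !inE => /orP[]/eqP ->; rewrite ?eqxx// (negPf ji).
    move=> /= Yij; have := Yij i; have := Yij j.
    rewrite /= !inE !eqxx orbT (negPf ji) => /(_ isT) Yj /(_ isT) Yi; by split.
  (* Every edge with its endpoint labels has the same joint law, [pi_ a * pi_ b] times the Bernoulli
     mass at [e], hence the same information. *)
  transitivity (\sum_(i < N) \sum_(j < N | (i < j)%N) I_edge i1 i2).
    apply: eq_bigr => i _; apply: eq_bigr => j ij.
    by apply: eq_mutual_information => // e [a b]; rewrite !edge_law// !YY.
  by rewrite sum_ltn_const mulr_natl.
Qed.
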